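(* Opposite polynomials generate the same 2-attractor: if $p$ and $q$ are opposite expanding polynomials with integer coefficients, leading coefficient $1$ and free terms in $\{2,-2\}$, then the 2-attractors generated by $p$ and by $q$ are the same up to affine similarity.
   Context: A polynomial is expanding if all its complex roots have modulus strictly greater than $1$. Polynomials $p=\sum_{k=0}^d p_kt^k$ and $q=\sum_{k=0}^d q_kt^k$ of degree $d$ are called opposite if $q_k=(-1)^{d-k}p_k$ for $k=0,\ldots,d$. For an integer $d\times d$ matrix $M$ with all eigenvalues of modulus greater than $1$ and $|\det M|=2$, and a digit set $D=\{\boldsymbol d_0,\boldsymbol d_1\}\subset\mathbb{Z}^d$ with $\boldsymbol d_1-\boldsymbol d_0\notin M\mathbb{Z}^d$, the 2-attractor generated by $M$ and $D$ is $G(M,D)=\{\sum_{k=1}^{\infty}M^{-k}\boldsymbol a_k : \boldsymbol a_k\in D \text{ for all } k\}\subset\mathbb{R}^d$. The 2-attractor generated by a polynomial $p$ is any $G(M,D)$ for which $M$ has characteristic polynomial $\det(\lambda I-M)=p(\lambda)$; it is defined uniquely up to affine similarity. Two subsets of $\mathbb{R}^d$ are affinely similar if one is the image of the other under an invertible affine map of $\mathbb{R}^d$. *)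

(* Defs.v *)
(* MathComp / MathComp-Analysis, over an arbitrary R : realType;
   complex numbers are R[i]. *)
From HB Require Import structures.
From mathcomp Require Import all_boot all_order all_algebra.
From mathcomp Require Import all_classical all_reals all_analysis.
From mathcomp Require Import complex.

Set Implicit Arguments.
Unset Strict Implicit.
Unset Printing Implicit Defensive.

Import Order.TTheory GRing.Theory Num.Theory.
Import numFieldNormedType.Exports.

Local Open Scope classical_set_scope.
Local Open Scope ring_scope.

(* The norm on R[i] takes values in R[i]; 1 < `|z| holds there exactly when
   the (real) modulus of z exceeds 1. *)
Definition expanding (R : realType) (p : {poly int}) : Prop :=
  forall z : R[i], root (map_poly intr p) z -> 1 < `|z|.

(* Recall that size p is 1 + deg p. *)
Definition opposite (d : nat) (p q : {poly int}) : Prop :=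
  [/\ size p = d.+1, size q = d.+1 &
      forall k : nat, (k <= d)%N -> q`_k = (-1) ^+ (d - k) * p`_k].

Definition expanding_mx (R : realType) (d : nat) (M : 'M[int]_d) : Prop :=
  forall z : R[i], eigenvalue (map_mx intr M : 'M[R[i]]_d) z -> 1 < `|z|.

Definition two_digit_set (d : nat) (M : 'M[int]_d) (D : set 'cV[int]_d) : Prop :=
  exists d0 d1 : 'cV[int]_d,
    D = [set d0; d1] /\ ~ (exists w : 'cV[int]_d, d1 - d0 = M *m w).

(* The term of index k (from 0) of the series is M^-(k+1) a_(k+1), with the
   digit a_(k+1) stored as a k. *)
Definition attractor (R : realType) (d : nat) (M : 'M[int]_d)
    (D : set 'cV[int]_d) : set 'cV[R]_d :=
  [set x | exists a : nat -> 'cV[int]_d, (forall k, D (a k)) /\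
     series (fun k => invmx (map_mx intr M : 'M[R]_d) ^+ k.+1
                        *m map_mx intr (a k)) @ \oo --> x].

(* The attractor of a polynomial is only defined up to affine similarity,
   hence a predicate rather than a function. *)
Definition two_attractor_of (R : realType) (d : nat) (p : {poly int})
    (G : set 'cV[R]_d) : Prop :=
  exists (M : 'M[int]_d) (D : set 'cV[int]_d),
    [/\ expanding_mx R M, `|\det M| = 2, two_digit_set M D,
        char_poly M = p & G = attractor M D].

Definition affinely_similar (R : realType) (d : nat) (G H : set 'cV[R]_d) : Prop :=
  exists (A : 'M[R]_d) (b : 'cV[R]_d),
    A \in unitmx /\ H = [set A *m x + b | x in G].

(* Main.v *)
(* If M has characteristic polynomial p, then -M has characteristic polynomial
   q.  Up to translation the attractor of M is the set of sums of c_k M^-k v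
   with c_k in {0, 1} and v = d1 - d0; since M^-k = (-1)^k (-M)^-k, replacing
   c_k by 1 - c_k for odd k turns it into a translate of the corresponding set
   for -M.  It remains to compare -M with another matrix N of characteristic
   polynomial q.  A proper integer factor of q has constant term greater than 1
   in absolute value, because its roots have modulus greater than 1, and two
   such constant terms cannot multiply to 2 or -2.  So q is irreducible over the
   rationals, every nonzero integer vector is cyclic for -M and for N, and some
   invertible P conjugates -M to N and sends v to e1 - e0. *)
Require Import Defs.
From HB Require Import structures.
From mathcomp Require Import all_boot all_order all_algebra.
From mathcomp Require Import all_classical all_reals all_analysis.
From mathcomp Require Import complex zify ring.

Set Implicit Arguments.
Unset Strict Implicit.
Unset Printing Implicit Defensive.

Import Order.TTheory GRing.Theory Num.Theory.
Import numFieldNormedType.Exports.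
Local Open Scope classical_set_scope.
Local Open Scope ring_scope.

(** * Irreducibility of expanding polynomials *)

Lemma prodr_gt1 (K : numDomainType) (s : seq K) :
  s != [::] -> (forall x, x \in s -> 1 < x) -> 1 < \prod_(x <- s) x.
Proof.
elim: s => // x [|y s] IHs _ s1; first by rewrite big_seq1 s1 ?mem_head.
rewrite big_cons mulr_egt1 ?(s1 x) ?mem_head //.
by apply: IHs => // z zs; rewrite s1 // in_cons zs orbT.
Qed.

Section ExpandingPolynomials.

Variable R : realType.

(** Up to sign, the constant term is the leading coefficient times the product of the complex roots,
    and this product is not empty. *)
Lemma expanding_coef0_gt1 (f : {poly int}) :
  expanding R f -> `|lead_coef f| = 1 -> size f != 1%N -> 1 < `|f`_0|.
Proof.
move=> fexp lf sf.
pose fC : {poly R[i]} := map_poly intr f.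
have [s Es] := closed_field_poly_normal fC.
have intr_inj : injective (intr : int -> R[i]) by exact: intr_inj.
have lfC : lead_coef fC = (lead_coef f)%:~R.
  by rewrite /fC lead_coef_map_inj // rmorph0.
have lfC0 : lead_coef fC != 0.
  by rewrite lfC intr_eq0 -normr_eq0 lf oner_eq0.
have sfC : size fC = (size s).+1 by rewrite Es size_scale // size_prod_XsubC.
rewrite -(ltr1z R[i]) intr_norm -(coef_map_id0 _ (f := intr)) ?rmorph0 // -/fC.
rewrite -horner_coef0 Es hornerZ normrM lfC -intr_norm lf mul1r.
rewrite horner_prod normr_prod -(big_map (fun z => `|('X - z%:P).[0]|) xpredT id).
apply: prodr_gt1.
  rewrite -size_eq0 size_map; apply: contra sf => /eqP s0.
  by rewrite -(size_map_inj_poly intr_inj (rmorph0 _)) -/fC sfC s0.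
move=> _ /mapP[z zs ->]; rewrite !hornerE normrN; apply: fexp.
by rewrite -/fC Es rootZ // root_prod_XsubC.
Qed.

(** By Gauss's lemma a rational divisor comes from an integer factorization, so the constant terms
    of both factors are integers. *)
Lemma expanding_irreducible (q : {poly int}) :
  expanding R q -> q \is monic -> size q != 1%N -> `|q`_0| = 2 ->
  irreducible_poly (map_poly intr q : {poly rat}).
Proof.
move=> qexp qm sq q0.
have size_intr (h : {poly int}) : size (map_poly intr h : {poly rat}) = size h.
  by rewrite size_map_inj_poly // ?rmorph0 //; exact: intr_inj.
have sq1 : (1 < size q)%N.
  by rewrite ltn_neqAle eq_sym sq lt0n size_poly_eq0 monic_neq0.
split=> [|f sf /dvdpP_rat_int[g [a a0 Ef] [r Eq]]]; first by rewrite size_intr.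
have [gexp rexp] : expanding R g /\ expanding R r.
  by split=> z z0; apply: qexp; rewrite Eq rmorphM rootM z0 ?orbT.
have [lg lr] : `|lead_coef g| = 1 /\ `|lead_coef r| = 1.
  have /(congr1 absz) : lead_coef g * lead_coef r = 1.
    by rewrite -lead_coefM -Eq (monicP qm).
  by rewrite abszM => /eqP; rewrite muln_eq1 -!abszE => /andP[/eqP-> /eqP->].
have [sr|sr] := eqVneq (size r) 1%N; last first.
  have sg : size g != 1%N by move: sf; rewrite Ef size_scale // size_intr.
  have := expanding_coef0_gt1 gexp lg sg; have := expanding_coef0_gt1 rexp lr sr.
  by move: q0; rewrite Eq coef0M normrM; nia.
have /size_poly1P[c c0 Er] : size r == 1%N by rewrite sr.
rewrite Ef Eq Er rmorphM /= map_polyC /= mulrC mul_polyC.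
by rewrite (eqp_ltrans (eqp_scale _ a0)) eqp_sym eqp_scale // intr_eq0.
Qed.

End ExpandingPolynomials.

(** * Cyclic vectors and conjugacy of matrices *)

Section Krylov.

(** Over a field, this is invertible exactly when [v] is a cyclic vector of [A]. *)
Definition krylov (K : pzRingType) n (A : 'M[K]_n.+1) (v : 'cV[K]_n.+1) :
  'M[K]_n.+1 := \matrix_(i, j) (A ^+ j *m v) i 0.

Lemma col_krylov (K : pzRingType) n (A : 'M[K]_n.+1) (v : 'cV[K]_n.+1) j :
  col j (krylov A v) = A ^+ j *m v.
Proof. by apply/colP => i; rewrite !mxE. Qed.

Lemma map_krylov (K L : pzRingType) (f : {rmorphism K -> L}) n
    (A : 'M[K]_n.+1) (v : 'cV[K]_n.+1) :
  map_mx f (krylov A v) = krylov (map_mx f A) (map_mx f v).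
Proof.
apply/matrixP => i j; rewrite /krylov [LHS]mxE [in LHS]mxE [RHS]mxE.
by rewrite -rmorphXn -map_mxM [RHS]mxE.
Qed.

Lemma horner_mx_krylov (K : comNzRingType) n (A : 'M[K]_n.+1)
    (v : 'cV[K]_n.+1) (f : {poly K}) :
  (size f <= n.+1)%N -> horner_mx A f *m v = krylov A v *m \col_j f`_j.
Proof.
move=> sf.
have Ef : f = \sum_(j < n.+1) f`_j *: 'X^j.
  rewrite -poly_def; apply/polyP => i; rewrite coef_poly.
  by case: ltnP => // ni; rewrite nth_default // (leq_trans sf ni).
rewrite [in LHS]Ef linear_sum mulmx_suml; apply/colP => i; rewrite summxE mxE.
apply: eq_bigr => j _; rewrite linearZ /= rmorphXn /= horner_mx_X -scalemxAl.
by rewrite !mxE mulrC.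
Qed.

(* The matrix on the right depends on A only through its characteristic
   polynomial, which is what makes two cyclic matrices conjugate. *)
Lemma mulmx_krylov (F : fieldType) n (A : 'M[F]_n.+1) (v : 'cV[F]_n.+1) :
  A *m krylov A v =
  krylov A v *m \matrix_(i, j < n.+1) ('X^(j.+1) %% char_poly A)`_i.
Proof.
apply/matrixP => i j.
have /colP/(_ i) : A *m col j (krylov A v) = krylov A v *m
    \col_i ('X^(j.+1) %% char_poly A)`_i.
  rewrite col_krylov -horner_mx_krylov; last first.
    by rewrite -ltnS -(size_char_poly A) ltn_modp monic_neq0 ?char_poly_monic.
  rewrite mulmxA [A *m _](_ : _ = horner_mx A 'X^(j.+1)); last first.
    by rewrite rmorphXn /= horner_mx_X exprS.
  rewrite {1}(divp_eq 'X^(j.+1) (char_poly A)) rmorphD rmorphM /=.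
  by rewrite Cayley_Hamilton mulr0 add0r.
rewrite colE mulmxA -colE mxE => ->; rewrite !mxE.
by apply: eq_bigr => k _; rewrite !mxE.
Qed.

(** A nonzero kernel vector lists the coefficients of a nonzero [f] of degree at most [n] with
    [f(A) v = 0]. Being coprime to the irreducible characteristic polynomial, [f] has [f(A)]
    invertible by Bezout, so [v = 0]. *)
Lemma krylov_unitmx (F : fieldType) n (A : 'M[F]_n.+1) (v : 'cV[F]_n.+1) :
  irreducible_poly (char_poly A) -> v != 0 -> krylov A v \in unitmx.
Proof.
move=> irrA; apply: contraR; rewrite unitmxE unitfE negbK -det_tr.
move=> /det0P[c c0 /(congr1 trmx)]; rewrite trmx_mul trmxK trmx0 => Kc.
pose f := rVpoly c.
have f0 : f != 0 by apply: contra c0 => /eqP f0; rewrite -(rVpolyK c) -/f f0 linear0.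
have sf : (size f <= n.+1)%N by exact: size_poly.
have fA : horner_mx A f *m v = 0.
  rewrite horner_mx_krylov // -Kc; congr (_ *m _).
  by apply/colP => i; rewrite !mxE coef_rVpoly_ord.
have : coprimep (char_poly A) f.
  rewrite irreducible_poly_coprime //; apply/negP => /(dvdp_leq f0).
  by rewrite size_char_poly leqNgt ltnS sf.
move=> /Bezout_eq1_coprimepP[[a b] /= /(congr1 (fun g => horner_mx A g *m v))].
rewrite rmorphD !rmorphM rmorph1 /= Cayley_Hamilton mulr0 add0r -mulmxE.
by rewrite -mulmxA fA mulmx0 mul1mx => <-.
Qed.

End Krylov.

(** [P] carries the Krylov basis of [A] and [v] to that of [B] and [w]; in these bases both matrices
    become the same companion matrix. *)
Lemma intertwiner (K : numFieldType) n (A B : 'M[int]_n.+1) (v w : 'cV[int]_n.+1) :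
  irreducible_poly (map_poly intr (char_poly A) : {poly rat}) ->
  char_poly A = char_poly B -> v != 0 -> w != 0 ->
  exists P : 'M[K]_n.+1, [/\ P \in unitmx,
    P *m map_mx intr A = map_mx intr B *m P & P *m map_mx intr v = map_mx intr w].
Proof.
move=> irrA AB v0 w0.
have unitK (C : 'M[int]_n.+1) (u : 'cV[int]_n.+1) : char_poly A = char_poly C ->
    u != 0 -> krylov (map_mx intr C : 'M[K]_n.+1) (map_mx intr u) \in unitmx.
  (* The Krylov determinant is an integer, so its vanishing can be tested over [rat], where
     irreducibility is available. *)
  move=> AC u0; rewrite -map_krylov unitmxE unitfE det_map_mx intr_eq0.
  rewrite -(intr_eq0 rat) -det_map_mx -unitfE -unitmxE map_krylov.
  apply: krylov_unitmx; first by rewrite -map_char_poly -AC.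
  apply: contra u0 => /eqP/matrixP u0; apply/eqP/matrixP => i j.
  by have /eqP := u0 i j; rewrite !mxE intr_eq0 => /eqP.
have KA := unitK A v erefl v0; have KB := unitK B w AB w0.
set kA := krylov _ _ in KA; set kB := krylov _ _ in KB.
exists (kB *m invmx kA); split; first by rewrite unitmx_mul KB unitmx_inv.
- apply: (can_inj (mulmxK KA)); rewrite -!mulmxA mulmx_krylov mulVmx // mulmx1.
  rewrite mulKmx // mulmx_krylov; congr (_ *m _).
  by apply/matrixP => i j; rewrite !mxE -!map_char_poly AB.
- have -> : map_mx intr v = col 0 kA by rewrite col_krylov expr0 mul1mx.
  by rewrite colE -mulmxA mulKmx // -colE col_krylov expr0 mul1mx.
Qed.

(** * The characteristic polynomial of [- A] *)

Lemma coef_comp_polyN (K : comNzRingType) (p : {poly K}) k :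
  (p \Po - 'X)`_k = (-1) ^+ k * p`_k.
Proof.
elim/poly_ind: p k => [|p c IHp] k; first by rewrite comp_poly0 !coef0 mulr0.
rewrite comp_poly_MXaddC mulrN !coefD coefN !coefMX !coefC.
by case: k => [|k] /=; rewrite ?oppr0 ?mul1r // !addr0 IHp exprS mulN1r mulNr.
Qed.

Lemma coef_char_polyN (K : comNzRingType) n (A : 'M[K]_n) k : (k <= n)%N ->
  (char_poly (- A))`_k = (-1) ^+ (n - k) * (char_poly A)`_k.
Proof.
move=> kn.
have -> : char_poly (- A) = (-1) ^+ n * (char_poly A \Po - 'X).
  rewrite /char_poly -[_ \Po _]/(comp_poly (- 'X) _) -det_map_mx -detZ.
  congr (\det _); apply/matrixP => i j; rewrite !mxE raddfN raddfB /= comp_polyC.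
  by rewrite rmorphMn /= comp_polyX mulNrn mulN1r opprB !opprK addrC.
rewrite mulrC -(rmorphN1 polyC) -rmorphXn /= coefMC coef_comp_polyN.
(* The exponents [n + k] and [n - k] differ by the even number [2k]. *)
rewrite mulrC mulrA -exprD -{1}(subnK kn) -addnA exprD addnn -mul2n.
by rewrite exprM sqrrN !expr1n mulr1.
Qed.

(** * Geometric decay of inverse powers and convergence of series *)

(* By Cayley-Hamilton the hypothesis on V holds for V = 1 and s the roots of the
   characteristic polynomial; a general V lets the factors be removed one at a
   time, through N^-(k+1) V = z^-1 (N^-k V - N^-(k+1) (N - z) V). *)
Lemma exp_invmx_bound (K : numFieldType) n (N : 'M[K]_n.+1) (s : seq K)
    (V : 'M[K]_n.+1) :
  N \is a GRing.unit -> (forall z, z \in s -> 1 < `|z|) ->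
  \prod_(z <- s) (N - z%:M) * V = 0 ->
  exists C r, [/\ 0 <= C, 0 < r, r < 1 &
    forall k i j, `|(N^-1 ^+ k * V) i j| <= C * r ^+ k].
Proof.
move=> uN; elim/last_ind: s V => [|s z IHs] V s1.
  rewrite big_nil mul1r => ->; exists 0, 2^-1.
  split; rewrite ?invr_gt0 ?invf_lt1 ?ltr1n // => k i j.
  by rewrite mulr0 mxE normr0 mul0r.
(* The last factor is absorbed into [V]: the induction hypothesis bounds the powers applied to
   [(N - z) V]. *)
rewrite -cats1 big_cat big_seq1 /= -mulrA => /IHs[z' zs|C [r [C0 r0 r1 bU]]].
  by rewrite s1 // mem_rcons in_cons zs orbT.
have z1 : 1 < `|z| by rewrite s1 // mem_rcons mem_head.
have z0 : z != 0 by rewrite -normr_gt0 (lt_trans ltr01).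
pose m := `|z|^-1.
have m0 : 0 < m by rewrite invr_gt0 (lt_trans ltr01).
have m1 : m < 1 by rewrite invf_lt1 // (lt_trans ltr01).
(* Chosen so that [1 - t = (1 - r) * (1 - m)] and [t - m = r * (1 - m)]: the new rate stays below 1
   and exceeds [m] by a known gap. *)
pose t := r + m * (1 - r).
have tm : t - m = r * (1 - m) by rewrite /t; ring.
have rt : r <= t by rewrite lerDl mulr_ge0 ?ltW // subr_gt0.
have t1 : t < 1.
  rewrite -subr_gt0 (_ : 1 - t = (1 - r) * (1 - m)); last by rewrite /t; ring.
  by rewrite mulr_gt0 // subr_gt0.
have rm0 : 0 < r * (1 - m) by rewrite mulr_gt0 // subr_gt0.
(* [S] dominates every entry of [V], which settles exponent 0; the other summand of [C'] gives
   [C <= C' * (t - m)]. *)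
pose S := \sum_i \sum_j `|V i j|.
have S0 : 0 <= S by apply: sumr_ge0 => i _; apply: sumr_ge0.
pose C' := C / (r * (1 - m)) + S.
have Cge0 : 0 <= C / (r * (1 - m)) by rewrite divr_ge0 // ltW.
exists C', t; split; rewrite ?addr_ge0 ?(lt_le_trans r0) //.
elim=> [|k IHk] i j.
  rewrite expr0 mul1r mulr1; apply: (@le_trans _ _ S); last by rewrite lerDr.
  rewrite /S (bigD1 i) //= (bigD1 j) //= -addrA lerDl addr_ge0 ?sumr_ge0 // => i' _.
  exact: sumr_ge0.
have -> : N^-1 ^+ k.+1 * V =
    z^-1 *: (N^-1 ^+ k * V - N^-1 ^+ k.+1 * ((N - z%:M) * V)).
  have -> : N^-1 ^+ k.+1 * ((N - z%:M) * V) = N^-1 ^+ k * V - z *: (N^-1 ^+ k.+1 * V).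
    rewrite mulrA mulrBr {1}exprSr mulrVK // mulrBl; congr (_ - _).
    by rewrite -scalemx1 -scalerAr mulr1 -scalerAl.
  by rewrite opprB addrCA subrr addr0 scalerA mulVf // scale1r.
rewrite mxE normrM normfV -/m mxE [X in _ + X]mxE.
(* The gap [t - m] leaves room in [C' * t ^+ k.+1] for the term in [(N - z) V]. *)
have Ct : C * r ^+ k.+1 <= C' * (t - m) * t ^+ k.
  have rk : r ^+ k.+1 <= t ^+ k.
    apply: (@le_trans _ _ (r ^+ k)); first by rewrite ler_wiXn2l ?ltW.
    by rewrite lerXn2r ?nnegrE ?(le_trans (ltW r0)) // ltW.
  apply: (le_trans (ler_wpM2l C0 rk)).
  rewrite ler_wpM2r ?exprn_ge0 ?(le_trans (ltW r0)) //.
  by rewrite tm -ler_pdivrMr // lerDl.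
apply: (@le_trans _ _ (m * (C' * t ^+ k + C * r ^+ k.+1))).
  apply: ler_wpM2l (ltW m0) _ _ _; apply: le_trans (ler_normB _ _) _.
  by rewrite lerD.
rewrite mulrDr -lerBrDl; apply: (@le_trans _ _ (C * r ^+ k.+1)).
  by rewrite ler_piMl ?(ltW m1) // mulr_ge0 ?exprn_ge0 ?(ltW r0).
by apply: (le_trans Ct); rewrite exprS le_eqVlt; apply/orP; left; apply/eqP; ring.
Qed.

Section Convergence.
Variable R : realType.

Lemma norm_real_complex (x : R) : `|real_complex R x| = real_complex R `|x|.
Proof. by rewrite normc_def /= expr0n addr0 sqrtr_sqr. Qed.

(** Eigenvalues may be non-real, so the estimate is made over [R[i]]; its constants are nonnegative,
    hence real, and it descends to [R]. *)
Lemma exp_invmx_real_bound n (M : 'M[int]_n.+1) :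
  expanding R (char_poly M) -> \det M != 0 ->
  exists C r : R, [/\ 0 <= C, 0 < r, r < 1 &
    forall k i j, `|(invmx (map_mx intr M) ^+ k) i j| <= C * r ^+ k].
Proof.
move=> Mexp detM.
have Mu : (map_mx intr M : 'M[R[i]]_n.+1) \is a GRing.unit.
  by rewrite -[_ \is a _]/(_ \in unitmx) unitmxE unitfE det_map_mx intr_eq0.
have [s Es] := closed_field_poly_normal (map_poly intr (char_poly M) : {poly R[i]}).
have lM : lead_coef (map_poly intr (char_poly M) : {poly R[i]}) = 1.
  by rewrite map_char_poly (monicP (char_poly_monic _)).
rewrite lM scale1r in Es.
have s1 z : z \in s -> 1 < `|z|.
  by move=> zs; apply: Mexp; rewrite Es root_prod_XsubC.
have M0 : \prod_(z <- s) (map_mx intr M - z%:M) * 1 = 0 :> 'M[R[i]]_n.+1.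
  rewrite mulr1 -(Cayley_Hamilton (map_mx intr M)) -map_char_poly Es.
  rewrite rmorph_prod; apply: eq_bigr => z _.
  by rewrite rmorphB /= horner_mx_X horner_mx_C.
have [C [r [C0 r0 r1 bM]]] := exp_invmx_bound Mu s1 M0.
have /complex_realP[c Ec] := ger0_real C0.
have /complex_realP[t Et] := gtr0_real r0.
subst C r; exists c, t; split; rewrite -?(ler0c c) -?(ltcR t 1) -?(ltcR 0 t) // => k i j.
have := bM k i j; rewrite mulr1 -rmorphXn -rmorphM -lecR -norm_real_complex.
congr (`|_| <= _).
have -> : map_mx intr M = map_mx (real_complex R) (map_mx intr M).
  by apply/matrixP => i' j'; rewrite !mxE rmorph_int.
by rewrite -[_^-1]/(invmx _) -map_invmx -rmorphXn /= mxE.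
Qed.

Lemma cvg_mx m n (f : nat -> 'M[R]_(m, n)) (A : 'M[R]_(m, n)) :
  (forall i j, (fun k => f k i j) @ \oo --> A i j) -> f @ \oo --> A.
Proof.
move=> fA; apply/cvg_ballP => e e0.
have : \forall k \near \oo, forall i j, ball (A i j) e (f k i j).
  apply: filter_forall => i; apply: filter_forall => j.
  by have /cvg_ballP := fA i j; apply.
by apply: filterS => k; split.
Qed.

Lemma cvg_mulmx m n p (A : 'M[R]_(m, n)) (f : nat -> 'M[R]_(n, p)) (B : 'M[R]_(n, p)) :
  f @ \oo --> B -> (fun k => A *m f k) @ \oo --> A *m B.
Proof.
move=> fB; apply: cvg_mx => i j.
rewrite mxE; under eq_fun do rewrite mxE.
apply: (cvg_big add_continuous) => l _; apply: cvgMl_tmp.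
exact: (cvg_comp f (fun M : 'M[R]_(n, p) => M l j) fB (@coord_continuous _ n p l j B)).
Qed.

(** Each coordinate is dominated by a geometric series. This will supply the translation part of the
    affine map. *)
Lemma is_cvg_series_exp_invmx n (M : 'M[int]_n.+1) (u : nat -> 'cV[R]_n.+1) (U : R) :
  expanding R (char_poly M) -> \det M != 0 -> (forall k j, `|u k j 0| <= U) ->
  exists b : 'cV[R]_n.+1,
    series (fun k => invmx (map_mx intr M) ^+ k.+1 *m u k) @ \oo --> b.
Proof.
move=> Mexp detM uU.
have [C [r [C0 r0 r1 bM]]] := exp_invmx_real_bound Mexp detM.
set g := (fun k => _ *m _).
have U0 : 0 <= U by apply: le_trans (uU 0 0); rewrite ?normr_ge0.
have gi i : cvgn (series (fun k => g k i 0)).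
  apply: normed_cvg.
  (* [n.+1] counts the summands of a matrix-vector product; the extra [r] comes from the exponent
     [k.+1]. *)
  apply: (@series_le_cvg _ _ (geometric (n.+1%:R * (C * r * U)) r)).
  - by move=> k; rewrite normr_ge0.
  - by move=> k; rewrite /geometric /= !mulr_ge0 ?exprn_ge0 ?ler0n // ltW.
  - move=> k; rewrite /geometric /= /g mxE (le_trans (ler_norm_sum _ _ _)) //.
    rewrite [leRHS](_ : _ = \sum_(j < n.+1) C * r ^+ k.+1 * U); last first.
      by rewrite sumr_const card_ord -mulr_natr exprS; ring.
    by apply: ler_sum => j _; rewrite normrM ler_pM.
  - by apply: is_cvg_geometric_series; rewrite ger0_norm // ltW.
exists (\col_i limn (series (fun k => g k i 0))).
apply: cvg_mx => i j; rewrite ord1 mxE.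
have -> : (fun k => series g k i 0) = series (fun k => g k i 0).
  by apply/funext => k; rewrite /series /= summxE.
exact: gi.
Qed.

End Convergence.

(** * The affine map between the attractors *)

(** With boolean codes, exchanging the digits at chosen positions becomes an exclusive or. *)
Lemma attractor_two_digits (R : realType) n (M : 'M[int]_n) (d0 d1 : 'cV[int]_n) :
  attractor M [set d0; d1] =
  [set x : 'cV[R]_n | exists c : nat -> bool,
     series (fun k => invmx (map_mx intr M : 'M[R]_n) ^+ k.+1
                        *m map_mx intr (if c k then d1 else d0)) @ \oo --> x].
Proof.
apply/seteqP; split=> x [a].
  move=> [Da ax]; exists (fun k => a k != d0).
  rewrite (_ : (fun k => _) = (fun k => invmx (map_mx intr M : 'M[R]_n) ^+ k.+1
                        *m map_mx intr (a k))) //.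
  apply/funext => k; congr (_ *m map_mx _ _).
  by case: (Da k) => ->; [rewrite eqxx | case: eqVneq].
move=> cx; exists (fun k => if a k then d1 else d0); split=> // k.
by case: (a k); [right|left].
Qed.

Lemma attractor_opposite (R : realType) n (M N : 'M[int]_n.+1)
    (d0 d1 e0 e1 : 'cV[int]_n.+1) (P : 'M[R]_n.+1) :
  \det M != 0 -> \det N != 0 -> expanding R (char_poly N) -> P \in unitmx ->
  P *m map_mx intr (- M) = map_mx intr N *m P ->
  P *m map_mx intr (d1 - d0) = map_mx intr (e1 - e0) ->
  affinely_similar (attractor M [set d0; d1])
    (attractor N [set e0; e1] : set 'cV[R]_n.+1).
Proof.
move=> detM detN Nexp uP PM Pv.
have uM : (map_mx intr M : 'M[R]_n.+1) \in unitmx.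
  by rewrite unitmxE unitfE det_map_mx intr_eq0.
have uN : (map_mx intr N : 'M[R]_n.+1) \in unitmx.
  by rewrite unitmxE unitfE det_map_mx intr_eq0.
set Mi := invmx (map_mx intr M : 'M[R]_n.+1).
set Ni := invmx (map_mx intr N : 'M[R]_n.+1).
have PMi : P *m Mi = - (Ni *m P).
  apply: (can_inj (mulmxK uM)); rewrite mulmxKV // mulNmx -mulmxA -!mulmxN.
  by rewrite -map_mxN PM mulKmx.
have PMik k : P *m Mi ^+ k = (-1) ^+ k *: (Ni ^+ k *m P).
  elim: k => [|k IHk]; first by rewrite !expr0 scale1r mul1mx mulmx1.
  rewrite exprSr -mulmxE mulmxA IHk -scalemxAl -mulmxA PMi mulmxN scalerN mulmxA.
  by rewrite mulmxE -exprSr [in RHS]exprS mulN1r scaleNr.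
(* The flipped digit for [N] minus the signed image under [P] of the digit for [M]. It is written
   for the digit [d0], but [d1] gives the same value since [P] sends [d1 - d0] to [e1 - e0]. *)
pose u k : 'cV[R]_n.+1 := map_mx intr (if odd k.+1 then e1 else e0)
  - (-1) ^+ k.+1 *: (P *m map_mx intr d0).
pose U := \sum_j (`|(map_mx intr e0 : 'cV[R]_n.+1) j 0|
  + `|(map_mx intr e1 : 'cV[R]_n.+1) j 0| + `|(P *m map_mx intr d0) j 0|).
have uU k j : `|u k j 0| <= U.
  rewrite /U (bigD1 j) //=; apply: ler_wpDr; first by apply: sumr_ge0.
  rewrite /u mxE [X in _ + X]mxE [X in _ - X]mxE (le_trans (ler_normB _ _)) // lerD //.
    by case: ifP => _; rewrite ?lerDl ?lerDr.
  by rewrite normrM normrX normrN1 expr1n mul1r.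
have [b sb] := is_cvg_series_exp_invmx Nexp detN uU; rewrite -/Ni in sb.
pose g (c : nat -> bool) k := Mi ^+ k.+1 *m map_mx intr (if c k then d1 else d0).
pose h (c : nat -> bool) k := Ni ^+ k.+1 *m map_mx intr (if c k then e1 else e0).
have Pd1 : P *m map_mx intr d1 = map_mx intr e1 - map_mx intr e0 + P *m map_mx intr d0.
  by rewrite -map_mxB -Pv map_mxB mulmxBr subrK.
(* The affine relation already holds between partial sums. Index [k] carries the power [k.+1],
   whence the parity of [k.+1]. *)
have gh (c : nat -> bool) : series (h (fun k => c k (+) odd k.+1)) =
    (fun m => P *m series (g c) m + series (fun k => Ni ^+ k.+1 *m u k) m).
  apply/funext => m; rewrite /series mulmx_sumr -big_split.
  apply: eq_bigr => k _; rewrite /h /g /u.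
  rewrite mulmxA PMik -signr_odd; move: (odd k.+1) => o /=.
  rewrite -scalemxAl -mulmxA scalemxAr -mulmxDr; congr (_ *m _).
  case: o; case: (c k); rewrite /= ?expr0 ?expr1 ?scale1r ?scaleN1r.
  - by rewrite Pd1 opprK opprD opprB (addrC (map_mx _ e1)) addrA !subrK.
  - by rewrite opprK addrC addrK.
  - by rewrite Pd1 (addrC (map_mx _ e0)) addrA addrK subrK.
  - by rewrite addrC subrK.
exists P, b; split=> //; rewrite !attractor_two_digits; apply/seteqP; split=> y /=.
(* Flipping is an involution, so the same recoding yields the preimage. *)
- move=> [c cy]; exists (invmx P *m (y - b)); last by rewrite mulKVmx // subrK.
  exists (fun k => c k (+) odd k.+1).
  rewrite (_ : series _ = fun m => invmx P *m (series (h c) m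
      - series (fun k => Ni ^+ k.+1 *m u k) m)).
    by apply: cvg_mulmx; apply: cvgB.
  apply/funext => m.
  have := gh (fun k => c k (+) odd k.+1).
  rewrite (_ : h _ = h c); last by apply/funext=> k; rewrite /h addbK.
  by move=> ->; rewrite addrK mulKmx.
- move=> [x [c cx] <-]; exists (fun k => c k (+) odd k.+1).
  rewrite -/(h (fun k => c k (+) odd k.+1)) gh.
  by apply: cvgD => //; apply: cvg_mulmx.
Qed.

Theorem proposition6 (R : realType) (d : nat) (p q : {poly int})
    (hopp : opposite d p q)
    (hp : expanding R p) (hq : expanding R q)
    (hpm : p \is monic) (hqm : q \is monic)
    (hp0 : p`_0 = 2 \/ p`_0 = - 2) (hq0 : q`_0 = 2 \/ q`_0 = - 2)
    (G H : set 'cV[R]_d)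
    (hG : two_attractor_of p G) (hH : two_attractor_of q H) :
  affinely_similar G H.
Proof.
case: hopp => sp sq pq.
(* A constant monic [q] would have free term 1. This also rules out [d = 0]. *)
have sq1 : size q != 1%N.
  apply/negP => /size_poly1P[c c0 Eq]; move: hqm hq0; rewrite Eq monicE lead_coefC.
  by rewrite coefC => /eqP->; case.
case: d sp sq pq G H hG hH => [|n] sp sq pq G H; first by rewrite sq in sq1.
case=> M [_ [_ detM [d0 [d1 [-> vM]]] Mp ->]].
case=> N [_ [_ detN [e0 [e1 [-> wN]]] Nq ->]].
have NMq : char_poly (- M) = q.
  apply/polyP => k; have [kn|nk] := leqP k n.+1.
    by rewrite coef_char_polyN // Mp pq.
  by rewrite !nth_default ?size_char_poly ?sq.
have neq0 (A : 'M[int]_n.+1) (v : 'cV_n.+1) : ~ (exists w, v = A *m w) -> v != 0.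
  by move=> Av; apply/eqP => v0; apply: Av; exists 0; rewrite mulmx0.
have det0 (A : 'M[int]_n.+1) : `|\det A| = 2 -> \det A != 0.
  by move=> A2; rewrite -normr_eq0 A2.
have irrq : irreducible_poly (map_poly intr q : {poly rat}).
  by apply: (expanding_irreducible hq) => //; case: hq0 => ->.
have [||||P [uP PM Pv]] := @intertwiner R n (- M) N (d1 - d0) (e1 - e0).
- by rewrite NMq.
- by rewrite NMq Nq.
- exact: neq0 vM.
- exact: neq0 wN.
by apply: (attractor_opposite _ _ _ uP PM Pv); rewrite ?Nq ?det0.
Qed.
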